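(* INF proves: if the set $\mathbb{N}$ of Church numbers is not finite, then $\mathbb{N}$ is infinite.
   Context: INF (intuitionistic New Foundations) is the first-order theory with equality over intuitionistic logic, with one binary predicate $\in$, whose axioms are extensionality ($\forall z(z\in x\leftrightarrow z\in y)\to x=y$) and stratified comprehension (the set $\{x:\varphi\}$ exists for every stratified $\varphi$, parameters allowed; $\varphi$ is stratified if its variables can be assigned natural-number indices so that in each subformula $x\in y$ the index of $y$ is one more than that of $x$, and in each $x=y$ the indices agree). Ordered pairs are $\langle x,y\rangle=\{\{x\},\{x,y\}\}$. $\mathrm{FUNC}=\{f:\forall x,y,z(\langle x,y\rangle\in f\to\langle x,z\rangle\in f\to y=z)\}$. Application: $Ap(f,x)=\{t:\exists y(\langle x,y\rangle\in f\land t\in y)\}$, so $Ap(f,x)=y$ if $f\in\mathrm{FUNC}$ and $\langle x,y\rangle\in f$. Write $fx$ for $Ap(f,x)$, associating to the left. Church numbers: $\mathbf{0}=\{\langle f,\mathrm{id}\rangle: f=f\}$ with $\mathrm{id}=\{\langle x,x\rangle:x=x\}$. Church successor is the set of all pairs $\langle z,s_z\rangle$ with $z\in\mathrm{FUNC}$, where $s_z$ is the set of all $\langle f,p\rangle$ with $f\in\mathrm{FUNC}$ and $\forall u\,(u\in p\leftrightarrow\exists x,w,t,q\,(u=\langle x,w\rangle\land t\in\mathrm{FUNC}\land\langle f,t\rangle\in z\land\langle x,q\rangle\in t\land\langle q,w\rangle\in f))$; it is denoted $\mathsf{S}$. $\mathbb{N}$ is the intersection of all sets containing $\mathbf{0}$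 and closed under $\mathsf{S}$. A set is finite if it belongs to $\mathrm{FINITE}$, the intersection of all sets $w$ with $\emptyset\in w$ and $\forall x,c\,(x\in w\land c\notin x\to x\cup\{c\}\in w)$. A set $X$ is infinite (Dedekind) if there is $Y\subseteq X$ with $Y\neq X$ and $X\sim Y$, where $X\sim Y$ means that some relation is a one-to-one function from $X$ onto $Y$. *)

(* Defs.v *)
From Stdlib Require Import List.

(** * First-order logic with equality and one binary predicate

    Variables are de Bruijn indices, and are the only terms, so that
    substitution of a term is a renaming. *)

Inductive form : Type :=
| Bot : form
| In  : nat -> nat -> form
| Eq  : nat -> nat -> form
| And : form -> form -> form
| Or  : form -> form -> form
| Imp : form -> form -> form
| All : form -> form
| Ex  : form -> form.

Definition Iff (A B : form) : form := And (Imp A B) (Imp B A).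

Definition scons {X : Type} (a : X) (s : nat -> X) (n : nat) : X :=
  match n with 0 => a | S k => s k end.

Definition up (r : nat -> nat) : nat -> nat := scons 0 (fun k => S (r k)).

Fixpoint ren (r : nat -> nat) (A : form) : form :=
  match A with
  | Bot => Bot
  | In x y => In (r x) (r y)
  | Eq x y => Eq (r x) (r y)
  | And A B => And (ren r A) (ren r B)
  | Or A B => Or (ren r A) (ren r B)
  | Imp A B => Imp (ren r A) (ren r B)
  | All A => All (ren (up r) A)
  | Ex A => Ex (ren (up r) A)
  end.

Definition shift (A : form) : form := ren S A.

(** [inst t A] replaces variable 0 of [A] by the variable [t]. *)
Definition inst (t : nat) (A : form) : form := ren (scons t (fun k => k)) A.

(** Intuitionistic natural deduction from a theory [T].  An axiom of [T] with
    free variables is understood as universally quantified: it may be used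
    under any context, and its free variables are not protected in
    [nd_AllI] and [nd_ExE]. *)
Inductive nd (T : form -> Prop) : list form -> form -> Prop :=
| nd_Ax   G A : T A -> nd T G A
| nd_Hyp  G A : List.In A G -> nd T G A
| nd_BotE G A : nd T G Bot -> nd T G A
| nd_AndI G A B : nd T G A -> nd T G B -> nd T G (And A B)
| nd_AndE1 G A B : nd T G (And A B) -> nd T G A
| nd_AndE2 G A B : nd T G (And A B) -> nd T G B
| nd_OrI1 G A B : nd T G A -> nd T G (Or A B)
| nd_OrI2 G A B : nd T G B -> nd T G (Or A B)
| nd_OrE  G A B C :
    nd T G (Or A B) -> nd T (A :: G) C -> nd T (B :: G) C -> nd T G C
| nd_ImpI G A B : nd T (A :: G) B -> nd T G (Imp A B)
| nd_ImpE G A B : nd T G (Imp A B) -> nd T G A -> nd T G B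
| nd_AllI G A : nd T (map shift G) A -> nd T G (All A)
| nd_AllE G A t : nd T G (All A) -> nd T G (inst t A)
| nd_ExI  G A t : nd T G (inst t A) -> nd T G (Ex A)
| nd_ExE  G A C :
    nd T G (Ex A) -> nd T (A :: map shift G) (shift C) -> nd T G C
| nd_EqI  G t : nd T G (Eq t t)
| nd_EqE  G A s t : nd T G (Eq s t) -> nd T G (inst s A) -> nd T G (inst t A).

(** * The theory INF *)

(** [strat s A]: the indices [s] of the free variables of [A] extend to its
    bound variables.  Every binder gets its own index, as if the bound
    variables had been given distinct names. *)
Fixpoint strat (s : nat -> nat) (A : form) : Prop :=
  match A with
  | Bot => True
  | In x y => s y = S (s x)
  | Eq x y => s x = s y
  | And A B | Or A B | Imp A B => strat s A /\ strat s B
  | All A | Ex A => exists k, strat (scons k s) A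
  end.

Definition stratified (A : form) : Prop := exists s, strat s A.

Definition extensionality : form :=
  All (All (Imp (All (Iff (In 0 2) (In 0 1))) (Eq 1 0))).

(** The set of all [x] such that [A], where [x] is variable 0 of [A] and the
    other free variables are parameters; the renaming keeps the new set from
    being captured in [A]. *)
Definition comprehension (A : form) : form :=
  Ex (All (Iff (In 0 1) (ren (up S) A))).

Inductive INF : form -> Prop :=
| INF_ext : INF extensionality
| INF_comp A : stratified A -> INF (comprehension A).

Definition INF_proves (A : form) : Prop := nd INF nil A.

(** * A named syntax for formulas

    A variable is denoted by the number of binders above its own (its level),
    which does not change when further binders are crossed, and a formula is
    a function of the number of binders above it.  At depth [n], level [x] is
    the index [n - S x]. *)

Definition var : Type := nat.
Definition hform : Type := nat -> form.

Definition sentence (A : hform) : form := A 0.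

Definition hBot : hform := fun _ => Bot.
Definition hIn (x y : var) : hform := fun n => In (n - S x) (n - S y).
Definition hEq (x y : var) : hform := fun n => Eq (n - S x) (n - S y).
Definition hAnd (A B : hform) : hform := fun n => And (A n) (B n).
Definition hOr (A B : hform) : hform := fun n => Or (A n) (B n).
Definition hImp (A B : hform) : hform := fun n => Imp (A n) (B n).
Definition hIff (A B : hform) : hform := fun n => Iff (A n) (B n).
Definition hAll (A : var -> hform) : hform := fun n => All (A n (S n)).
Definition hEx (A : var -> hform) : hform := fun n => Ex (A n (S n)).

Declare Scope hform_scope.
Delimit Scope hform_scope with hf.
Bind Scope hform_scope with hform.

Notation "⊥" := hBot : hform_scope.
Notation "x ∈ y" := (hIn x y) (at level 70, no associativity) : hform_scope.
Notation "x ≐ y" := (hEq x y) (at level 70, no associativity) : hform_scope.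
Notation "¬ A" := (hImp A hBot) (at level 75, right associativity) : hform_scope.
Notation "A ∧ B" := (hAnd A B) (at level 80, right associativity) : hform_scope.
Notation "A ∨ B" := (hOr A B) (at level 85, right associativity) : hform_scope.
Notation "A ⟺ B" := (hIff A B) (at level 95, no associativity) : hform_scope.
Notation "A ⟹ B" := (hImp A B) (at level 99, right associativity) : hform_scope.
Notation "∀ x .. y , A" := (hAll (fun x => .. (hAll (fun y => A)) ..))
  (at level 200, x binder, y binder, right associativity) : hform_scope.
Notation "∃ x .. y , A" := (hEx (fun x => .. (hEx (fun y => A)) ..))
  (at level 200, x binder, y binder, right associativity) : hform_scope.

Open Scope hform_scope.

(** * Sets of INF

    A term {x : P x} is represented by the class [P], as the language has no
    set terms: [u] in {x : P x} is written [P u], and the other contexts are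
    eliminated with [is_set] and [mem]. *)

Definition class : Type := var -> hform.

Definition is_set (a : var) (P : class) : hform := ∀ x, x ∈ a ⟺ P x.
Definition mem (P : class) (w : var) : hform := ∃ a, is_set a P ∧ a ∈ w.

Definition elts (a : var) : class := fun x => x ∈ a.
Definition empty : class := fun _ => ⊥.
Definition adjoin (x c : var) : class := fun u => u ∈ x ∨ u ≐ c.
Definition single (x : var) : class := fun u => u ≐ x.
Definition upair (x y : var) : class := fun u => u ≐ x ∨ u ≐ y.

(** [is_pair p x y]: [p] is the pair <x,y>. *)
Definition is_pair (p x y : var) : hform :=
  is_set p (fun u => is_set u (single x) ∨ is_set u (upair x y)).

(** [pair_in x y F]: the pair <x,y> belongs to [F]. *)
Definition pair_in (x y : var) (F : class) : hform := ∃ p, is_pair p x y ∧ F p.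

Definition FUNC (f : var) : hform :=
  ∀ x y z, pair_in x y (elts f) ⟹ pair_in x z (elts f) ⟹ y ≐ z.

Definition Ap (F : class) (x : var) : class :=
  fun t => ∃ y, pair_in x y F ∧ t ∈ y.

Definition identity : class := fun u => ∃ x, x ≐ x ∧ is_pair u x x.

Definition zero : class :=
  fun u => ∃ f i, f ≐ f ∧ is_set i identity ∧ is_pair u f i.

(** The set s_z. *)
Definition succ_of (z : var) : class := fun v =>
  ∃ f p, is_pair v f p ∧ FUNC f ∧
    (∀ u, u ∈ p ⟺
       ∃ x w t q, is_pair u x w ∧ FUNC t ∧ pair_in f t (elts z)
                  ∧ pair_in x q (elts t) ∧ pair_in q w (elts f)).

Definition Succ : class := fun v =>
  ∃ z s, is_pair v z s ∧ FUNC z ∧ is_set s (succ_of z).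

Definition NN : class := fun x =>
  ∀ w, mem zero w ∧ (∀ z, z ∈ w ⟹ mem (Ap Succ z) w) ⟹ x ∈ w.

Definition finite (a : var) : hform :=
  ∀ w, mem empty w ∧ (∀ x c, x ∈ w ∧ ¬ c ∈ x ⟹ mem (adjoin x c) w) ⟹ a ∈ w.

Definition relation (f : var) : hform := ∀ p, p ∈ f ⟹ ∃ x y, is_pair p x y.

Definition one_to_one_onto (f a b : var) : hform :=
  relation f ∧ FUNC f
  ∧ (∀ x, x ∈ a ⟺ ∃ y, pair_in x y (elts f))
  ∧ (∀ y, y ∈ b ⟺ ∃ x, pair_in x y (elts f))
  ∧ (∀ x z y, pair_in x y (elts f) ⟹ pair_in z y (elts f) ⟹ x ≐ z).

Definition similar (a b : var) : hform := ∃ f, one_to_one_onto f a b.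

Definition subset (a b : var) : hform := ∀ x, x ∈ a ⟹ x ∈ b.

Definition infinite (a : var) : hform :=
  ∃ b, subset b a ∧ ¬ b ≐ a ∧ similar a b.

(* Main.v *)
(** If the successor loops, the Church numbers form a finite set.  Assume they
    do not form one.  By induction, every Church number [k] ends a finite
    segment: a finite set of Church numbers containing zero, and containing with
    each element other than [k] its successor; the successor of [k] is not in
    it, since otherwise the segment would be closed and would contain every
    Church number.  For the same reason zero is not a successor.  Of any two
    Church numbers, one lies in a segment that the other ends, so that two
    numbers with the same successor are equal or make a segment loop.  Thus
    the successor maps the Church numbers one-to-one into those different
    from zero.

    Derivability is handled by a Kripke-style semantics whose worlds are the
    contexts: [holds (sem s A) G] is equivalent to [nd INF G (ren s A)].  The
    domain is constant, since a universally quantified variable can be taken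
    fresh for the context. *)

From Stdlib Require Import List Arith Lia.
Require Import Defs.
Import ListNotations.

(** * Renaming *)

Lemma up_ext (r r' : nat -> nat) (m : nat) :
  (forall k, k < m -> r k = r' k) -> forall k, k < m -> up r k = up r' k.
Proof.
  intros E [|k] Hk; cbn; [reflexivity|]. now rewrite E by lia.
Qed.

Lemma ren_ext (r r' : nat -> nat) (A : form) :
  (forall k, r k = r' k) -> ren r A = ren r' A.
Proof.
  revert r r'. induction A; intros r r' E; cbn; f_equal; auto.
  all: apply IHA; intros [|k]; cbn; congruence.
Qed.

Lemma ren_ren (r r' : nat -> nat) (A : form) :
  ren r (ren r' A) = ren (fun k => r (r' k)) A.
Proof.
  revert r r'. induction A; intros r r'; cbn; f_equal; auto.
  all: rewrite IHA; apply ren_ext; now intros [|k].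
Qed.

Lemma ren_id (A : form) : ren (fun k => k) A = A.
Proof.
  induction A; cbn; f_equal; auto.
  all: rewrite <- IHA at 2; apply ren_ext; now intros [|k].
Qed.

Lemma ren_inst (r : nat -> nat) (t : nat) (A : form) :
  ren r (inst t A) = inst (r t) (ren (up r) A).
Proof.
  unfold inst. rewrite !ren_ren. apply ren_ext. now intros [|k].
Qed.

Lemma ren_shift (r : nat -> nat) (A : form) :
  ren (up r) (shift A) = shift (ren r A).
Proof.
  unfold shift. now rewrite !ren_ren.
Qed.

Lemma map_ren_shift (r : nat -> nat) (G : list form) :
  map (ren (up r)) (map shift G) = map shift (map (ren r) G).
Proof.
  rewrite !map_map. apply map_ext. apply ren_shift.
Qed.

Lemma inst_ren_up (r : nat -> nat) (t : nat) (A : form) :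
  inst t (ren (up r) A) = ren (scons t r) A.
Proof.
  unfold inst. rewrite ren_ren. apply ren_ext. now intros [|k].
Qed.

(** The bound [m] on the relevant indices is what fresh variables are chosen from. *)
Lemma ren_finite_support (A : form) :
  exists m, forall r r', (forall k, k < m -> r k = r' k) -> ren r A = ren r' A.
Proof.
  induction A as [|x y|x y|A [m1 H1] B [m2 H2]|A [m1 H1] B [m2 H2]
                 |A [m1 H1] B [m2 H2]|A [m H]|A [m H]].
  - now exists 0.
  - exists (S (x + y)). intros r r' E. cbn. rewrite !E by lia. reflexivity.
  - exists (S (x + y)). intros r r' E. cbn. rewrite !E by lia. reflexivity.
  - exists (m1 + m2). intros r r' E. cbn.
    f_equal; [apply H1|apply H2]; intros; apply E; lia.
  - exists (m1 + m2). intros r r' E. cbn.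
    f_equal; [apply H1|apply H2]; intros; apply E; lia.
  - exists (m1 + m2). intros r r' E. cbn.
    f_equal; [apply H1|apply H2]; intros; apply E; lia.
  - exists m. intros r r' E. cbn. f_equal. apply H. now apply up_ext.
  - exists m. intros r r' E. cbn. f_equal. apply H. now apply up_ext.
Qed.

Lemma map_ren_finite_support (G : list form) :
  exists m, forall r r', (forall k, k < m -> r k = r' k) ->
    map (ren r) G = map (ren r') G.
Proof.
  induction G as [|A G [m1 H1]].
  - now exists 0.
  - destruct (ren_finite_support A) as [m2 H2].
    exists (m1 + m2). intros r r' E. cbn.
    f_equal; [apply H2|apply H1]; intros; apply E; lia.
Qed.

(** * Stratification and derivations under renaming *)

Lemma strat_ext (s s' : nat -> nat) (A : form) :
  (forall k, s k = s' k) -> strat s A -> strat s' A.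
Proof.
  revert s s'. induction A; intros s s' E; cbn;
    rewrite <- ?E; intuition eauto.
  all: destruct H as [k H]; exists k; eapply IHA; [|exact H];
    intros [|j]; cbn; auto.
Qed.

Lemma strat_ren (s r : nat -> nat) (A : form) :
  strat (fun k => s (r k)) A -> strat s (ren r A).
Proof.
  revert s r. induction A; intros s r; cbn; intuition auto.
  all: destruct H as [k H]; exists k; apply IHA; eapply strat_ext; [|exact H];
    now intros [|j].
Qed.

(* Identifying variables can destroy stratification, hence the left inverse. *)
Lemma INF_ren (r l : nat -> nat) (A : form) :
  (forall k, l (r k) = k) -> INF A -> INF (ren r A).
Proof.
  intros L [|B [s Hs]].
  - apply INF_ext.
  - replace (ren r (comprehension B)) with (comprehension (ren (up r) B)).
    + apply INF_comp. exists (fun k => s (up l k)). apply strat_ren.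
      eapply strat_ext; [|exact Hs]. intros [|k]; cbn; now rewrite ?L.
    + assert (E : ren (up (up r)) (ren (up S) B) = ren (up S) (ren (up r) B)).
      { rewrite !ren_ren. apply ren_ext. now intros [|k]. }
      cbn. now rewrite E.
Qed.

Lemma nd_ren (r l : nat -> nat) (G : list form) (A : form) :
  (forall k, l (r k) = k) -> nd INF G A -> nd INF (map (ren r) G) (ren r A).
Proof.
  intros L H. revert r l L. induction H; intros r l L; cbn in *.
  - apply nd_Ax. eapply INF_ren; eauto.
  - apply nd_Hyp. now apply in_map.
  - apply nd_BotE. eauto.
  - apply nd_AndI; eauto.
  - eapply nd_AndE1; eauto.
  - eapply nd_AndE2; eauto.
  - apply nd_OrI1; eauto.
  - apply nd_OrI2; eauto.
  - eapply nd_OrE; eauto.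
  - apply nd_ImpI; eauto.
  - eapply nd_ImpE; eauto.
  - apply nd_AllI. rewrite <- map_ren_shift. apply (IHnd (up r) (up l)).
    intros [|k]; cbn; now rewrite ?L.
  - rewrite ren_inst. apply nd_AllE. eauto.
  - apply nd_ExI with (r t). rewrite <- ren_inst. eauto.
  - eapply nd_ExE; [eauto|].
    rewrite <- map_ren_shift, <- ren_shift. apply (IHnd2 (up r) (up l)).
    intros [|k]; cbn; now rewrite ?L.
  - apply nd_EqI.
  - rewrite ren_inst. apply nd_EqE with (r s); [eauto|].
    rewrite <- ren_inst. eauto.
Qed.

Lemma nd_weaken (G G' : list form) (A : form) :
  incl G G' -> nd INF G A -> nd INF G' A.
Proof.
  intros I H. revert G' I. induction H; intros G' I.
  - now apply nd_Ax.
  - apply nd_Hyp. auto.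
  - apply nd_BotE. auto.
  - apply nd_AndI; auto.
  - eapply nd_AndE1; eauto.
  - eapply nd_AndE2; eauto.
  - apply nd_OrI1; auto.
  - apply nd_OrI2; auto.
  - eapply nd_OrE; eauto; [apply IHnd2|apply IHnd3];
      apply incl_cons; cbn; auto using incl_tl.
  - apply nd_ImpI. apply IHnd. apply incl_cons; cbn; auto using incl_tl.
  - eapply nd_ImpE; eauto.
  - apply nd_AllI. apply IHnd. now apply incl_map.
  - apply nd_AllE. auto.
  - eapply nd_ExI. eauto.
  - eapply nd_ExE; [eauto|]. apply IHnd2.
    apply incl_cons; cbn; auto using incl_tl, incl_map.
  - apply nd_EqI.
  - eapply nd_EqE; eauto.
Qed.

(* A fresh variable [x] is moved to index 0 by the injection sending [x] to 0
   and every other [k] to [S k], which acts as [S] on the other formulas. *)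
Lemma fresh_renaming (G : list form) (B : form) :
  exists x r l, (forall k, l (r k) = k) /\
    map (ren r) G = map shift G /\ ren r (inst x B) = B.
Proof.
  destruct (map_ren_finite_support G) as [m1 H1].
  destruct (ren_finite_support B) as [m2 H2].
  set (x := m1 + m2).
  exists x, (fun k => if Nat.eq_dec k x then 0 else S k),
    (scons x (fun k => k)).
  split; [|split].
  - intro k. destruct (Nat.eq_dec k x); cbn; congruence.
  - apply H1. intros k Hk. destruct (Nat.eq_dec k x); [lia|reflexivity].
  - unfold inst. rewrite ren_ren. rewrite <- (ren_id B) at 2. apply H2.
    intros [|k] Hk; cbn [scons].
    + destruct (Nat.eq_dec x x); [reflexivity|congruence].
    + destruct (Nat.eq_dec k x); [lia|reflexivity].
Qed.

Lemma nd_All_fresh (G : list form) (B : form) :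
  (forall x, nd INF G (inst x B)) -> nd INF G (All B).
Proof.
  intro H. destruct (fresh_renaming G B) as (x & r & l & L & EG & EB).
  apply nd_AllI. rewrite <- EG, <- EB. eapply nd_ren; eauto.
Qed.

Lemma nd_Ex_fresh (G : list form) (B C : form) :
  nd INF G (Ex B) -> (forall x, nd INF (inst x B :: G) C) -> nd INF G C.
Proof.
  intros H HC.
  (* The variable has to be fresh for the conclusion as well as for the context. *)
  destruct (fresh_renaming (C :: G) B) as (x & r & l & L & EG & EB).
  cbn in EG. injection EG as EC EG.
  apply nd_ExE with B; [exact H|].
  pose proof (nd_ren r l _ _ L (HC x)) as K. cbn in K.
  now rewrite EG, EB, EC in K.
Qed.

(** * Forcing *)

(** A context [G] is a world, whose extensions are the contexts containing it.
    [covered U G] is the local truth of [U] at [G]: whatever is derivable at the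
    extensions in [U] is derivable.  Disjunctions and existential quantifiers
    are interpreted up to covering, which makes the semantics complete. *)
Definition covered (U : list form -> Prop) (G : list form) : Prop :=
  forall G' C, incl G G' ->
    (forall G'', incl G' G'' -> U G'' -> nd INF G'' C) -> nd INF G' C.

Record wprop : Type := {
  holds : list form -> Prop;
  holds_mono : forall G G', incl G G' -> holds G -> holds G';
  holds_local : forall G, covered holds G -> holds G }.

Lemma covered_mono (U : list form -> Prop) (G G' : list form) :
  incl G G' -> covered U G -> covered U G'.
Proof.
  intros I H G'' C I' HC. apply H; [eapply incl_tran; eauto|exact HC].
Qed.

(** Covers compose; this makes [wOr] and [wEx] local. *)
Lemma covered_bind (U V : list form -> Prop) (G : list form) :
  covered U G ->
  (forall G', incl G G' -> U G' -> covered V G') -> covered V G.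
Proof.
  intros HU HV G' C I HC. apply HU; [exact I|].
  intros G'' I' U''. apply (HV G''); auto using incl_refl.
  - eapply incl_tran; eauto.
  - intros G3 I3. apply HC. eapply incl_tran; eauto.
Qed.

Lemma covered_unit (U : list form -> Prop) (G : list form) :
  (forall G', incl G G' -> U G') -> covered U G.
Proof.
  intros H G' C I HC. apply HC; auto using incl_refl.
Qed.

Definition atom (A : form) : wprop.
Proof.
  refine {| holds G := nd INF G A |}.
  - intros G G'. apply nd_weaken.
  - intros G H. apply H; auto using incl_refl.
Defined.

Definition wAnd (P Q : wprop) : wprop.
Proof.
  refine {| holds G := holds P G /\ holds Q G |}.
  - intros G G' I []. split; eapply holds_mono; eauto.
  - intros G H. split; apply holds_local; intros G' C I HC;
      (apply H; [exact I|]); intros G'' I' []; auto.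
Defined.

Definition wImp (P Q : wprop) : wprop.
Proof.
  refine {| holds G := forall G', incl G G' -> holds P G' -> holds Q G' |}.
  - intros G G' I H G'' I'. apply H. eapply incl_tran; eauto.
  - intros G H G' I HP. apply holds_local. intros G1 C I1 HC.
    apply H; [eapply incl_tran; eauto|].
    intros G2 I2 K. apply HC; [exact I2|]. apply K; [apply incl_refl|].
    eapply holds_mono; [|exact HP]. eapply incl_tran; eauto.
Defined.

Definition wAll (P : nat -> wprop) : wprop.
Proof.
  refine {| holds G := forall x, holds (P x) G |}.
  - intros G G' I H x. eapply holds_mono; eauto.
  - intros G H x. apply holds_local. intros G' C I HC.
    apply H; [exact I|]. intros G'' I' K. apply HC; [exact I'|apply K].
Defined.

Definition wOr (P Q : wprop) : wprop.
Proof.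
  refine {| holds := covered (fun G => holds P G \/ holds Q G) |}.
  - intros G G'. apply covered_mono.
  - intros G H. apply (covered_bind _ _ _ H). auto.
Defined.

Definition wEx (P : nat -> wprop) : wprop.
Proof.
  refine {| holds := covered (fun G => exists x, holds (P x) G) |}.
  - intros G G'. apply covered_mono.
  - intros G H. apply (covered_bind _ _ _ H). auto.
Defined.

Definition wBot : wprop := atom Bot.
Definition wIn (x y : nat) : wprop := atom (In x y).
Definition wEq (x y : nat) : wprop := atom (Eq x y).
Definition wIff (P Q : wprop) : wprop := wAnd (wImp P Q) (wImp Q P).

(** * Interpretation of formulas *)

Fixpoint sem (s : nat -> nat) (A : form) : wprop :=
  match A with
  | Bot => wBot
  | In x y => wIn (s x) (s y)
  | Eq x y => wEq (s x) (s y)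
  | And A B => wAnd (sem s A) (sem s B)
  | Or A B => wOr (sem s A) (sem s B)
  | Imp A B => wImp (sem s A) (sem s B)
  | All A => wAll (fun x => sem (scons x s) A)
  | Ex A => wEx (fun x => sem (scons x s) A)
  end.

(** Soundness and completeness in one induction. Covering handles [Or] and [Ex]; a fresh variable
    stands for all instances when [All] is introduced and [Ex] eliminated. *)
Lemma sem_nd (A : form) (s : nat -> nat) (G : list form) :
  holds (sem s A) G <-> nd INF G (ren s A).
Proof.
  revert s G. induction A; intros s G; cbn [sem ren]; try reflexivity.
  - cbn. rewrite IHA1, IHA2. split.
    + intros []. now apply nd_AndI.
    + intro H. split; [eapply nd_AndE1|eapply nd_AndE2]; eauto.
  - split.
    + intro H. apply H; [apply incl_refl|].
      intros G' I [H'|H']; [apply nd_OrI1, IHA1|apply nd_OrI2, IHA2]; auto.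
    + intros H G' C I HC. eapply nd_OrE; [eapply nd_weaken; eauto| |].
      * apply HC; [apply incl_tl, incl_refl|]. left. apply IHA1.
        apply nd_Hyp. now left.
      * apply HC; [apply incl_tl, incl_refl|]. right. apply IHA2.
        apply nd_Hyp. now left.
  - split.
    + intro H. apply nd_ImpI, IHA2, H; [apply incl_tl, incl_refl|].
      apply IHA1, nd_Hyp. now left.
    + intros H G' I HA. apply IHA2.
      eapply nd_ImpE; [eapply nd_weaken; eauto|]. now apply IHA1.
  - split.
    + intro H. apply nd_All_fresh. intro x. rewrite inst_ren_up. apply IHA, H.
    + intros H x. apply IHA. rewrite <- inst_ren_up. now apply nd_AllE.
  - split.
    + intro H. apply H; [apply incl_refl|]. intros G' I [x Hx].
      apply nd_ExI with x. rewrite inst_ren_up. now apply IHA.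
    + intros H G' C I HC. eapply nd_Ex_fresh; [eapply nd_weaken; eauto|].
      intro x. apply HC; [apply incl_tl, incl_refl|]. exists x.
      apply IHA. rewrite <- inst_ren_up. apply nd_Hyp. now left.
Qed.

Lemma sem_ren (r s : nat -> nat) (A : form) (G : list form) :
  holds (sem s (ren r A)) G <-> holds (sem (fun k => s (r k)) A) G.
Proof.
  now rewrite !sem_nd, ren_ren.
Qed.

Lemma sem_ext (s s' : nat -> nat) (A : form) (G : list form) :
  (forall k, s k = s' k) -> holds (sem s A) G -> holds (sem s' A) G.
Proof.
  intro E. rewrite !sem_nd. now rewrite (ren_ext s s' A E).
Qed.

Lemma sem_eq (s : nat -> nat) (A : form) (x y : nat) (G : list form) :
  holds (wEq x y) G ->
  holds (sem (scons x s) A) G -> holds (sem (scons y s) A) G.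
Proof.
  rewrite !sem_nd, <- !inst_ren_up. apply nd_EqE.
Qed.

(* Conversion must unfold [sem] before the connectives: comparing the unfolded
   connectives first does not terminate in reasonable time. *)
Strategy 1000 [wAnd wImp wAll wOr wEx wBot wIn wEq atom].

Declare Scope wprop_scope.
Delimit Scope wprop_scope with wp.
Bind Scope wprop_scope with wprop.

Notation "⊥" := wBot : wprop_scope.
Notation "x ∈ y" := (wIn x y) (at level 70, no associativity) : wprop_scope.
Notation "x ≐ y" := (wEq x y) (at level 70, no associativity) : wprop_scope.
Notation "¬ P" := (wImp P wBot) (at level 75, right associativity) : wprop_scope.
Notation "P ∧ Q" := (wAnd P Q) (at level 80, right associativity) : wprop_scope.
Notation "P ∨ Q" := (wOr P Q) (at level 85, right associativity) : wprop_scope.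
Notation "P ⟺ Q" := (wIff P Q) (at level 95, no associativity) : wprop_scope.
Notation "P ⟹ Q" := (wImp P Q) (at level 99, right associativity) : wprop_scope.
Notation "∀ x .. y , P" := (wAll (fun x => .. (wAll (fun y => P%wp)) ..))
  (at level 200, x binder, y binder, right associativity) : wprop_scope.
Notation "∃ x .. y , P" := (wEx (fun x => .. (wEx (fun y => P%wp)) ..))
  (at level 200, x binder, y binder, right associativity) : wprop_scope.
Notation "G ⊩ P" := (holds P%wp G) (at level 96, P at level 95).

(** * Logical rules for forcing *)

Lemma bot_elim (P : wprop) (G : list form) : G ⊩ ⊥ -> G ⊩ P.
Proof.
  intro H. apply holds_local. intros G' C I _.
  apply nd_BotE. eapply nd_weaken; eauto.
Qed.

Lemma imp_elim (P Q : wprop) (G : list form) :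
  G ⊩ (P ⟹ Q) -> G ⊩ P -> G ⊩ Q.
Proof.
  intros H. apply H, incl_refl.
Qed.

Lemma iff_elim_l (P Q : wprop) (G : list form) :
  G ⊩ P ⟺ Q -> G ⊩ P -> G ⊩ Q.
Proof.
  intros []. now apply imp_elim.
Qed.

Lemma iff_elim_r (P Q : wprop) (G : list form) :
  G ⊩ P ⟺ Q -> G ⊩ Q -> G ⊩ P.
Proof.
  intros []. now apply imp_elim.
Qed.

Lemma or_intro_l (P Q : wprop) (G : list form) : G ⊩ P -> G ⊩ P ∨ Q.
Proof.
  intro H. apply covered_unit. intros G' I. left. eapply holds_mono; eauto.
Qed.

Lemma or_intro_r (P Q : wprop) (G : list form) : G ⊩ Q -> G ⊩ P ∨ Q.
Proof.
  intro H. apply covered_unit. intros G' I. right. eapply holds_mono; eauto.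
Qed.

Lemma ex_intro_at (P : nat -> wprop) (x : nat) (G : list form) :
  G ⊩ P x -> G ⊩ (∃ x, P x).
Proof.
  intro H. apply covered_unit. intros G' I. exists x. eapply holds_mono; eauto.
Qed.

(** The cover given by the disjunction is discharged by the locality of [R], so the elimination
    works into every proposition, not only into atoms. *)
Lemma or_elim (P Q R : wprop) (G : list form) :
  G ⊩ P ∨ Q ->
  (forall G', incl G G' -> G' ⊩ P -> G' ⊩ R) ->
  (forall G', incl G G' -> G' ⊩ Q -> G' ⊩ R) -> G ⊩ R.
Proof.
  intros H HP HQ. apply holds_local. apply (covered_bind _ _ _ H).
  intros G' I K. apply covered_unit. intros G'' I'.
  eapply holds_mono; [exact I'|]. destruct K; auto.
Qed.

Lemma ex_elim (P : nat -> wprop) (R : wprop) (G : list form) :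
  G ⊩ (∃ x, P x) ->
  (forall x G', incl G G' -> G' ⊩ P x -> G' ⊩ R) -> G ⊩ R.
Proof.
  intros H HP. apply holds_local. apply (covered_bind _ _ _ H).
  intros G' I [x K]. apply covered_unit. intros G'' I'.
  eapply holds_mono; [exact I'|]. eauto.
Qed.

(* Transports every hypothesis from the world [G] to its extension [G'], which
   takes over the name [G]. *)
Ltac to_world G G' I :=
  repeat match goal with
    H : holds ?P G |- _ => apply (holds_mono P G G' I) in H
  end;
  clear I; clear G; rename G' into G.

Ltac world_of_goal := match goal with |- holds _ ?G => G end.

Tactic Notation "wintro" ident(H) :=
  let G := world_of_goal in
  let G' := fresh "G" in
  let I := fresh "I" in
  intros G' I H; to_world G G' I.

Tactic Notation "wex" hyp(H) "as" ident(x) simple_intropattern(p) :=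
  let G := world_of_goal in
  let G' := fresh "G" in
  let I := fresh "I" in
  let K := fresh "K" in
  apply (ex_elim _ _ G H); clear H;
  intros x G' I K; to_world G G' I; revert K; intros p.

Tactic Notation "wor" hyp(H) "as" ident(K) :=
  let G := world_of_goal in
  let G' := fresh "G" in
  let I := fresh "I" in
  apply (or_elim _ _ _ G H); clear H; intros G' I K; to_world G G' I.

Ltac wexists x := apply (ex_intro_at _ x).

(** * Sets *)

(* The last variable comes first: under three binders, [env [c; b; a]] sends
   the levels 0, 1 and 2 to [a], [b] and [c]. *)
Fixpoint env (l : list nat) : nat -> nat :=
  match l with
  | [] => fun k => k
  | a :: l => scons a (env l)
  end.

(* The connectives and predicates prefixed by [w] are the images under [sem] of
   the formulas of the same name; the two are convertible. *)
Definition wis_set (a : nat) (P : nat -> wprop) : wprop := ∀ x, x ∈ a ⟺ P x.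

Lemma set_elim (a : nat) (P : nat -> wprop) (x : nat) (G : list form) :
  G ⊩ wis_set a P -> G ⊩ x ∈ a -> G ⊩ P x.
Proof.
  intro H. apply (iff_elim_l _ _ _ (H x)).
Qed.

Lemma set_intro (a : nat) (P : nat -> wprop) (x : nat) (G : list form) :
  G ⊩ wis_set a P -> G ⊩ P x -> G ⊩ x ∈ a.
Proof.
  intro H. apply (iff_elim_r _ _ _ (H x)).
Qed.

Lemma eq_sym_w (x y : nat) (G : list form) : G ⊩ x ≐ y -> G ⊩ y ≐ x.
Proof.
  intro H. apply (sem_eq (env [x]) (Eq 0 1) x y G H). apply nd_EqI.
Qed.

Lemma eq_trans_w (x y z : nat) (G : list form) :
  G ⊩ x ≐ y -> G ⊩ y ≐ z -> G ⊩ x ≐ z.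
Proof.
  intros H K. exact (sem_eq (env [x]) (Eq 1 0) y z G K H).
Qed.

Lemma eq_in_l (x y a : nat) (G : list form) :
  G ⊩ x ≐ y -> G ⊩ x ∈ a -> G ⊩ y ∈ a.
Proof.
  exact (sem_eq (env [a]) (In 0 1) x y G).
Qed.

Lemma eq_in_r (x a b : nat) (G : list form) :
  G ⊩ a ≐ b -> G ⊩ x ∈ a -> G ⊩ x ∈ b.
Proof.
  exact (sem_eq (env [x]) (In 1 0) a b G).
Qed.

Lemma ext (a b : nat) (G : list form) :
  G ⊩ (∀ x, x ∈ a ⟺ x ∈ b) -> G ⊩ a ≐ b.
Proof.
  intro H.
  assert (E : G ⊩ (∀ a b, (∀ x, x ∈ a ⟺ x ∈ b) ⟹ a ≐ b)).
  { refine (proj2 (sem_nd extensionality (env []) G) _).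
    apply nd_Ax. apply INF_ext. }
  exact (imp_elim _ _ _ (E a b) H).
Qed.

Lemma set_unique (a b : nat) (P : nat -> wprop) (G : list form) :
  G ⊩ wis_set a P -> G ⊩ wis_set b P -> G ⊩ a ≐ b.
Proof.
  intros Ha Hb. apply ext. intro x. split; wintro H.
  - apply (set_intro _ _ _ _ Hb), (set_elim _ _ _ _ Ha H).
  - apply (set_intro _ _ _ _ Ha), (set_elim _ _ _ _ Hb H).
Qed.

(* An axiom stands for its universal closure, so its parameters can be
   instantiated arbitrarily, even by equal variables. *)
Lemma nd_env (l : list nat) (A : form) :
  nd INF [] A -> holds (sem (env l) A) [].
Proof.
  revert A. induction l as [|a l IH]; intros A H; cbn [env].
  - apply sem_nd. now rewrite ren_id.
  - assert (K : nd INF [] (All A)) by now apply nd_AllI.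
    exact (IH _ K a).
Qed.

Lemma comprehend (A : form) (l : list nat) (G : list form) :
  stratified A ->
  G ⊩ (∃ a, wis_set a (fun x => sem (scons x (env l)) A)).
Proof.
  intro HA.
  assert (H : holds (sem (env l) (comprehension A)) G).
  { apply (holds_mono _ []); [intros ? []|].
    apply nd_env, nd_Ax. now apply INF_comp. }
  change (G ⊩ (∃ a, wis_set a (fun x =>
    sem (scons x (scons a (env l))) (ren (up S) A)))) in H.
  wex H as a Ha. wexists a. intro x. destruct (Ha x) as [H1 H2].
  split; wintro K.
  - apply (imp_elim _ _ _ H1) in K. apply -> sem_ren in K.
    revert K. apply sem_ext. now intros [|k].
  - apply (imp_elim _ _ _ H2). apply <- sem_ren.
    revert K. apply sem_ext. now intros [|k].
Qed.

(* The indices are left open and found by unification. *)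
Ltac stratify :=
  unshelve
    (eexists (scons _ (scons _ (scons _ (scons _ (fun _ => 0))))); cbn;
     repeat first [exact I | reflexivity | apply conj | eapply ex_intro]);
  exact 0.

Definition wis_zero (z : nat) : wprop := sem (env [z]) (is_set 0 zero 1).
(** Membership of <x,y> in the successor forces x and y to the same index. Hence inductions and sets
    that mention the successor can be stratified. *)
Definition wsucc (x y : nat) : wprop :=
  sem (env [y; x]) (is_set 1 (Ap Succ 0) 2).

Lemma zero_ex (G : list form) : G ⊩ (∃ z, wis_zero z).
Proof.
  refine (comprehend (zero 0 1) [] G _). stratify.
Qed.

Lemma succ_ex (x : nat) (G : list form) : G ⊩ (∃ y, wsucc x y).
Proof.
  refine (comprehend (Ap Succ 0 1 2) [x] G _). stratify.
Qed.

Lemma zero_eq (z z' : nat) (G : list form) :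
  G ⊩ wis_zero z -> G ⊩ wis_zero z' -> G ⊩ z ≐ z'.
Proof.
  exact (set_unique z z' (fun x => sem (env [x]) (zero 0 1)) G).
Qed.

Lemma succ_unique (x y y' : nat) (G : list form) :
  G ⊩ wsucc x y -> G ⊩ wsucc x y' -> G ⊩ y ≐ y'.
Proof.
  exact (set_unique y y' (fun t => sem (env [t; x]) (Ap Succ 0 1 2)) G).
Qed.

Lemma succ_eq_l (x x' y : nat) (G : list form) :
  G ⊩ x ≐ x' -> G ⊩ wsucc x y -> G ⊩ wsucc x' y.
Proof.
  (* The two levels are exchanged with respect to [wsucc], since [sem_eq] replaces index 0. *)
  exact (sem_eq (env [y]) (is_set 0 (Ap Succ 1) 2) x x' G).
Qed.

Lemma succ_eq_r (x y y' : nat) (G : list form) :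
  G ⊩ y ≐ y' -> G ⊩ wsucc x y -> G ⊩ wsucc x y'.
Proof.
  exact (sem_eq (env [x]) (is_set 1 (Ap Succ 0) 2) y y' G).
Qed.

(** * Church numbers *)

Definition wNN (x : nat) : wprop :=
  ∀ w, (∃ a, wis_zero a ∧ a ∈ w)
       ∧ (∀ z, z ∈ w ⟹ ∃ a, wsucc z a ∧ a ∈ w) ⟹ x ∈ w.

Lemma zero_in_N (n z : nat) (G : list form) :
  G ⊩ wis_set n wNN -> G ⊩ wis_zero z -> G ⊩ z ∈ n.
Proof.
  intros Hn Hz. apply (set_intro _ _ _ _ Hn). intro w. wintro H.
  destruct H as [H _]. wex H as a [Ha Haw].
  exact (eq_in_l _ _ _ _ (zero_eq _ _ _ Ha Hz) Haw).
Qed.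

Lemma succ_in_N (n x y : nat) (G : list form) :
  G ⊩ wis_set n wNN -> G ⊩ x ∈ n -> G ⊩ wsucc x y -> G ⊩ y ∈ n.
Proof.
  intros Hn Hx Hs. apply (set_intro _ _ _ _ Hn). intro w. wintro H.
  pose proof (imp_elim _ _ _ (set_elim _ _ _ _ Hn Hx w) H) as Hxw.
  destruct H as [_ H]. pose proof (imp_elim _ _ _ (H x) Hxw) as K.
  wex K as a [Ha Haw].
  exact (eq_in_l _ _ _ _ (succ_unique _ _ _ _ Ha Hs) Haw).
Qed.

(** The inductive set is {x in n : A}, whence the conjunct [In 0 1] in the stratification
    hypothesis. It makes x ∈ n available in the successor step. *)
Lemma N_ind (A : form) (l : list nat) (n : nat) (G : list form) :
  stratified (And (In 0 1) A) ->
  G ⊩ wis_set n wNN ->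
  G ⊩ (∀ z, wis_zero z ⟹ sem (env (z :: n :: l)) A) ->
  G ⊩ (∀ x y, x ∈ n ⟹ wsucc x y ⟹ sem (env (x :: n :: l)) A
              ⟹ sem (env (y :: n :: l)) A) ->
  forall x, G ⊩ x ∈ n -> G ⊩ sem (env (x :: n :: l)) A.
Proof.
  intros Str Hn H0 HS x Hx.
  pose proof (comprehend _ (n :: l) G Str) as W. wex W as w Hw.
  cbn [sem] in Hw.
  enough (x_w : G ⊩ x ∈ w) by apply (set_elim _ _ _ _ Hw x_w).
  apply (imp_elim _ _ _ (set_elim _ _ _ _ Hn Hx w)). split.
  - pose proof (zero_ex G) as Z. wex Z as z Hz. wexists z.
    split; [exact Hz|]. apply (set_intro _ _ _ _ Hw).
    split; [exact (zero_in_N _ _ _ Hn Hz)|].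
    exact (imp_elim _ _ _ (H0 z) Hz).
  - intro u. wintro Hu. apply (set_elim _ _ _ _ Hw) in Hu.
    destruct Hu as [Hu Au].
    pose proof (succ_ex u G) as K. wex K as v Hv. wexists v.
    split; [exact Hv|]. apply (set_intro _ _ _ _ Hw).
    split; [exact (succ_in_N _ _ _ _ Hn Hu Hv)|].
    exact (imp_elim _ _ _ (imp_elim _ _ _ (imp_elim _ _ _ (HS u v) Hu) Hv) Au).
Qed.

(** * Finite sets and finite segments *)

Definition wis_empty (e : nat) : wprop := wis_set e (fun _ => wBot).
Definition wis_adjoin (b a c : nat) : wprop :=
  wis_set b (fun u => (u ∈ a ∨ u ≐ c)%wp).

Definition wfinite (a : nat) : wprop :=
  ∀ w, (∃ e, wis_empty e ∧ e ∈ w)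
       ∧ (∀ x c, x ∈ w ∧ ¬ c ∈ x ⟹ ∃ b, wis_adjoin b x c ∧ b ∈ w)
       ⟹ a ∈ w.

(** [A] is a finite initial segment of the Church numbers with last element
    [k]: every element other than [k] has its successor in [A]. *)
Definition wsegment (n k A : nat) : wprop :=
  wfinite A ∧ (∀ x, x ∈ A ⟹ x ∈ n) ∧ (∀ z, wis_zero z ⟹ z ∈ A) ∧ k ∈ A
  ∧ (∀ x, x ∈ A ⟹ x ≐ k ∨ ∃ y, wsucc x y ∧ y ∈ A).

(** The syntactic counterpart of [wsegment]: induction requires a formula whose stratification can
    be checked. *)
Definition segment (n k A : var) : hform :=
  (finite A ∧ (∀ x, x ∈ A ⟹ x ∈ n) ∧ (∀ z, is_set z zero ⟹ z ∈ A) ∧ k ∈ A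
   ∧ (∀ x, x ∈ A ⟹ x ≐ k ∨ ∃ y, is_set y (Ap Succ x) ∧ y ∈ A))%hf.

Lemma empty_ex (G : list form) : G ⊩ (∃ e, wis_empty e).
Proof.
  refine (comprehend Bot [] G _). stratify.
Qed.

Lemma adjoin_ex (a c : nat) (G : list form) : G ⊩ (∃ b, wis_adjoin b a c).
Proof.
  refine (comprehend (adjoin 0 1 2 3) [c; a] G _). stratify.
Qed.

Lemma finite_empty (e : nat) (G : list form) :
  G ⊩ wis_empty e -> G ⊩ wfinite e.
Proof.
  intros He w. wintro H. destruct H as [H _]. wex H as a [Ha Haw].
  exact (eq_in_l _ _ _ _ (set_unique _ _ _ _ Ha He) Haw).
Qed.

Lemma finite_adjoin (a b c : nat) (G : list form) :
  G ⊩ wfinite a -> G ⊩ (¬ c ∈ a) -> G ⊩ wis_adjoin b a c -> G ⊩ wfinite b.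
Proof.
  intros Ha Hc Hb w. wintro H.
  pose proof (imp_elim _ _ _ (Ha w) H) as Haw.
  destruct H as [_ H].
  pose proof (imp_elim _ _ _ (H a c) (conj Haw Hc)) as K.
  wex K as b' [Hb' Hbw].
  exact (eq_in_l _ _ _ _ (set_unique _ _ _ _ Hb' Hb) Hbw).
Qed.

(* A segment containing the successor of its last element is closed under
   successor, hence is the whole of [n]. *)
Lemma looping_segment (n k s A : nat) (G : list form) :
  G ⊩ wis_set n wNN -> G ⊩ wsegment n k A -> G ⊩ wsucc k s -> G ⊩ s ∈ A ->
  G ⊩ wfinite n.
Proof.
  intros Hn (Fin & Sub & Zero & Last & Step) Hs HsA.
  assert (E : G ⊩ A ≐ n).
  { apply ext. intro x. split; wintro Hx.
    - exact (imp_elim _ _ _ (Sub x) Hx).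
    - apply (imp_elim _ _ _ (set_elim _ _ _ _ Hn Hx A)). split.
      + pose proof (zero_ex G) as Z. wex Z as z Hz. wexists z.
        split; [exact Hz|]. exact (imp_elim _ _ _ (Zero z) Hz).
      + intro u. wintro Hu.
        pose proof (imp_elim _ _ _ (Step u) Hu) as K. wor K as K; [|exact K].
        wexists s. split; [|exact HsA].
        exact (succ_eq_l _ _ _ _ (eq_sym_w _ _ _ K) Hs). }
  intro w. wintro H.
  exact (eq_in_l _ _ _ _ E (imp_elim _ _ _ (Fin w) H)).
Qed.

(** [B] is [A] with [s] adjoined. Finiteness of [B] needs [s] to be new, and it is, as otherwise [A]
    would loop. The inclusion serves to keep a further number inside the segment in
    [common_segment]. *)
Lemma segment_succ (n k s A : nat) (G : list form) :
  G ⊩ wis_set n wNN -> G ⊩ (¬ wfinite n) ->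
  G ⊩ wsegment n k A -> G ⊩ wsucc k s ->
  G ⊩ (∃ B, wsegment n s B ∧ (∀ x, x ∈ A ⟹ x ∈ B)).
Proof.
  intros Hn NF HA Hs.
  assert (New : G ⊩ (¬ s ∈ A)).
  { wintro H. apply (imp_elim _ _ _ NF).
    exact (looping_segment n k s A G Hn HA Hs H). }
  destruct HA as (Fin & Sub & Zero & Last & Step).
  pose proof (adjoin_ex A s G) as K. wex K as B HB.
  assert (AB : G ⊩ (∀ x, x ∈ A ⟹ x ∈ B)).
  { intro x. wintro Hx. apply (set_intro _ _ _ _ HB). now apply or_intro_l. }
  assert (HsB : G ⊩ s ∈ B).
  { apply (set_intro _ _ _ _ HB). apply or_intro_r. apply nd_EqI. }
  wexists B. split; [|exact AB].
  split; [|split; [|split; [|split; [exact HsB|]]]].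
  - exact (finite_adjoin A B s G Fin New HB).
  - intro x. wintro Hx. apply (set_elim _ _ _ _ HB) in Hx. wor Hx as Hx.
    + exact (imp_elim _ _ _ (Sub x) Hx).
    + apply (eq_in_l _ _ _ _ (eq_sym_w _ _ _ Hx)).
      apply (succ_in_N n k _ _ Hn); [|exact Hs].
      exact (imp_elim _ _ _ (Sub k) Last).
  - intro z. wintro Hz. apply (imp_elim _ _ _ (AB z)).
    exact (imp_elim _ _ _ (Zero z) Hz).
  - intro x. wintro Hx. apply (set_elim _ _ _ _ HB) in Hx. wor Hx as Hx.
    + apply or_intro_r.
      pose proof (imp_elim _ _ _ (Step x) Hx) as K. wor K as K.
      * wexists s. split; [|exact HsB].
        exact (succ_eq_l _ _ _ _ (eq_sym_w _ _ _ K) Hs).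
      * wex K as y [Hy HyA]. wexists y. split; [exact Hy|].
        exact (imp_elim _ _ _ (AB y) HyA).
    + now apply or_intro_l.
Qed.

Lemma segment_zero (n z : nat) (G : list form) :
  G ⊩ wis_set n wNN -> G ⊩ wis_zero z -> G ⊩ (∃ A, wsegment n z A).
Proof.
  intros Hn Hz.
  pose proof (empty_ex G) as K. wex K as e He.
  pose proof (adjoin_ex e z G) as K. wex K as A HA.
  assert (A_eq : G ⊩ (∀ x, x ∈ A ⟹ x ≐ z)).
  { intro x. wintro Hx. apply (set_elim _ _ _ _ HA) in Hx.
    wor Hx as Hx; [|exact Hx].
    apply bot_elim. exact (set_elim _ _ _ _ He Hx). }
  wexists A. split; [|split; [|split; [|split]]].
  - apply (finite_adjoin e A z); [now apply finite_empty| |exact HA].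
    wintro H. exact (set_elim _ _ _ _ He H).
  - intro x. wintro Hx. apply (eq_in_l z); [|now apply zero_in_N].
    apply eq_sym_w. exact (imp_elim _ _ _ (A_eq x) Hx).
  - intro z'. wintro Hz'. apply (set_intro _ _ _ _ HA), or_intro_r.
    now apply zero_eq.
  - apply (set_intro _ _ _ _ HA), or_intro_r, nd_EqI.
  - intro x. wintro Hx. apply or_intro_l.
    exact (imp_elim _ _ _ (A_eq x) Hx).
Qed.

Lemma segment_ex (n x : nat) (G : list form) :
  G ⊩ wis_set n wNN -> G ⊩ (¬ wfinite n) -> G ⊩ x ∈ n ->
  G ⊩ (∃ A, wsegment n x A).
Proof.
  intros Hn NF.
  (* Level 0 is [n] and level 1 the induction variable, which has index 0 at depth 2. *)
  refine (N_ind ((∃ A, segment 0 1 A)%hf 2) [] n G _ Hn _ _ x).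
  - stratify.
  - change (G ⊩ (∀ z, wis_zero z ⟹ ∃ A, wsegment n z A)).
    intro z. wintro Hz. now apply segment_zero.
  - change (G ⊩ (∀ x y, x ∈ n ⟹ wsucc x y ⟹ (∃ A, wsegment n x A)
                        ⟹ ∃ A, wsegment n y A)).
    intros u v. wintro Hu. wintro Hv. wintro K. wex K as A HA.
    pose proof (segment_succ _ _ _ _ _ Hn NF HA Hv) as K. wex K as B [HB _].
    wexists B. exact HB.
Qed.

(** Induction on [x] with [y] fixed. Equality of numbers need not be decided: the case distinction
    comes from the disjunction in [wsegment]. *)
Lemma common_segment (n x y : nat) (G : list form) :
  G ⊩ wis_set n wNN -> G ⊩ (¬ wfinite n) -> G ⊩ y ∈ n -> G ⊩ x ∈ n ->
  G ⊩ (∃ A, wsegment n y A ∧ x ∈ A) ∨ (∃ A, wsegment n x A ∧ y ∈ A).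
Proof.
  intros Hn NF Hy.
  refine (N_ind (((∃ A, segment 1 0 A ∧ 2 ∈ A)
                  ∨ (∃ A, segment 1 2 A ∧ 0 ∈ A))%hf 3) [y] n G _ Hn _ _ x).
  - stratify.
  - change (G ⊩ (∀ x, wis_zero x ⟹
      (∃ A, wsegment n y A ∧ x ∈ A) ∨ (∃ A, wsegment n x A ∧ y ∈ A))).
    intro z. wintro Hz. apply or_intro_l.
    pose proof (segment_ex n y G Hn NF Hy) as K. wex K as A HA.
    wexists A. split; [exact HA|]. destruct HA as (_ & _ & Zero & _).
    exact (imp_elim _ _ _ (Zero z) Hz).
  - change (G ⊩ (∀ x x', x ∈ n ⟹ wsucc x x' ⟹
      (∃ A, wsegment n y A ∧ x ∈ A) ∨ (∃ A, wsegment n x A ∧ y ∈ A) ⟹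
      (∃ A, wsegment n y A ∧ x' ∈ A) ∨ (∃ A, wsegment n x' A ∧ y ∈ A))).
    intros u v. wintro Hu. wintro Hv. wintro K. wor K as K.
    + wex K as A [HA HuA].
      destruct (HA) as (_ & _ & _ & Last & Step).
      pose proof (imp_elim _ _ _ (Step u) HuA) as K. wor K as K.
      (* Here [u] equals [y]: the segment up to [y] is prolonged by the successor and still contains
         [y]. *)
      * apply or_intro_r.
        pose proof (segment_succ _ _ _ _ _ Hn NF HA
          (succ_eq_l _ _ _ _ K Hv)) as L. wex L as B [HB AB].
        wexists B. split; [exact HB|]. exact (imp_elim _ _ _ (AB y) Last).
      * apply or_intro_l. wexists A. split; [exact HA|].
        wex K as v' [Hv' HvA].
        exact (eq_in_l _ _ _ _ (succ_unique _ _ _ _ Hv' Hv) HvA).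
    + apply or_intro_r. wex K as A [HA HyA].
      pose proof (segment_succ _ _ _ _ _ Hn NF HA Hv) as L. wex L as B [HB AB].
      wexists B. split; [exact HB|]. exact (imp_elim _ _ _ (AB y) HyA).
Qed.

(* If [y] ends a segment that contains [x], then either [x = y] or the common
   successor lies in the segment, which loops. *)
Lemma succ_inj_in_segment (n x y s A : nat) (G : list form) :
  G ⊩ wis_set n wNN -> G ⊩ (¬ wfinite n) ->
  G ⊩ wsegment n y A -> G ⊩ x ∈ A -> G ⊩ wsucc x s -> G ⊩ wsucc y s ->
  G ⊩ x ≐ y.
Proof.
  intros Hn NF HA HxA Hx Hy.
  destruct (HA) as (_ & _ & _ & _ & Step).
  pose proof (imp_elim _ _ _ (Step x) HxA) as K. wor K as K; [exact K|].
  wex K as t [Ht HtA]. apply bot_elim, (imp_elim _ _ _ NF).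
  apply (looping_segment n y s A G Hn HA Hy).
  exact (eq_in_l _ _ _ _ (succ_unique _ _ _ _ Ht Hx) HtA).
Qed.

Lemma succ_inj (n x y s : nat) (G : list form) :
  G ⊩ wis_set n wNN -> G ⊩ (¬ wfinite n) ->
  G ⊩ x ∈ n -> G ⊩ y ∈ n -> G ⊩ wsucc x s -> G ⊩ wsucc y s ->
  G ⊩ x ≐ y.
Proof.
  intros Hn NF Hx Hy Hxs Hys.
  pose proof (common_segment n x y G Hn NF Hy Hx) as K.
  wor K as K; wex K as A [HA HA'].
  - exact (succ_inj_in_segment n x y s A G Hn NF HA HA' Hxs Hys).
  - apply eq_sym_w.
    exact (succ_inj_in_segment n y x s A G Hn NF HA HA' Hys Hxs).
Qed.

Lemma zero_not_succ (n x z : nat) (G : list form) :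
  G ⊩ wis_set n wNN -> G ⊩ (¬ wfinite n) ->
  G ⊩ x ∈ n -> G ⊩ wis_zero z -> G ⊩ wsucc x z -> G ⊩ ⊥.
Proof.
  intros Hn NF Hx Hz Hs. apply (imp_elim _ _ _ NF).
  pose proof (segment_ex n x G Hn NF Hx) as K. wex K as A HA.
  apply (looping_segment n x z A G Hn HA Hs).
  destruct HA as (_ & _ & Zero & _). exact (imp_elim _ _ _ (Zero z) Hz).
Qed.

(** * Pairs and functions *)

Definition wis_single (s x : nat) : wprop := wis_set s (fun v => wEq v x).
Definition wis_upair (d x y : nat) : wprop :=
  wis_set d (fun v => (v ≐ x ∨ v ≐ y)%wp).
Definition wis_pair (p x y : nat) : wprop :=
  wis_set p (fun u => (wis_single u x ∨ wis_upair u x y)%wp).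
Definition wpair_in (x y f : nat) : wprop := ∃ p, wis_pair p x y ∧ p ∈ f.

Lemma single_ex (x : nat) (G : list form) : G ⊩ (∃ s, wis_single s x).
Proof.
  refine (comprehend (single 0 1 2) [x] G _). stratify.
Qed.

Lemma upair_ex (x y : nat) (G : list form) : G ⊩ (∃ d, wis_upair d x y).
Proof.
  refine (comprehend (upair 0 1 2 3) [y; x] G _). stratify.
Qed.

Lemma pair_ex (x y : nat) (G : list form) : G ⊩ (∃ p, wis_pair p x y).
Proof.
  refine (comprehend ((is_set 2 (single 0) ∨ is_set 2 (upair 0 1))%hf 3)
            [y; x] G _). stratify.
Qed.

(** The element {x} of [p] is {x'} or {x',y'}, and contains x' in either case. *)
Lemma pair_fst (p x y x' y' : nat) (G : list form) :
  G ⊩ wis_pair p x y -> G ⊩ wis_pair p x' y' -> G ⊩ x ≐ x'.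
Proof.
  intros H H'. pose proof (single_ex x G) as K. wex K as s Hs.
  assert (Hsp : G ⊩ s ∈ p) by (apply (set_intro _ _ _ _ H), or_intro_l, Hs).
  apply (set_elim _ _ _ _ H') in Hsp. apply eq_sym_w.
  apply (set_elim _ _ _ _ Hs). wor Hsp as K; apply (set_intro _ _ _ _ K).
  - apply nd_EqI.
  - apply or_intro_l, nd_EqI.
Qed.

Lemma pair_snd_or (p x y x' y' : nat) (G : list form) :
  G ⊩ wis_pair p x y -> G ⊩ wis_pair p x' y' -> G ⊩ y ≐ x' ∨ y ≐ y'.
Proof.
  intros H H'. pose proof (upair_ex x y G) as K. wex K as d Hd.
  assert (Hdp : G ⊩ d ∈ p) by (apply (set_intro _ _ _ _ H), or_intro_r, Hd).
  assert (Hy : G ⊩ y ∈ d)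
    by (apply (set_intro _ _ _ _ Hd), or_intro_r, nd_EqI).
  apply (set_elim _ _ _ _ H') in Hdp. wor Hdp as K.
  - apply or_intro_l, (set_elim _ _ _ _ K Hy).
  - exact (set_elim _ _ _ _ K Hy).
Qed.

(** Applying [pair_snd_or] in both directions avoids deciding whether x = y. The only case left is y
    = x' and y' = x, which x = x' settles. *)
Lemma pair_snd (p x y x' y' : nat) (G : list form) :
  G ⊩ wis_pair p x y -> G ⊩ wis_pair p x' y' -> G ⊩ y ≐ y'.
Proof.
  intros H H'.
  pose proof (pair_snd_or _ _ _ _ _ _ H H') as K. wor K as K; [|exact K].
  pose proof (pair_snd_or _ _ _ _ _ _ H' H) as L.
  wor L as L; [|now apply eq_sym_w].
  pose proof (pair_fst _ _ _ _ _ _ H H') as E.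
  exact (eq_trans_w _ _ _ _ K
    (eq_trans_w _ _ _ _ (eq_sym_w _ _ _ E) (eq_sym_w _ _ _ L))).
Qed.

(** * One-to-one functions and infinite sets *)

Definition wFUNC (f : nat) : wprop :=
  ∀ x y z, wpair_in x y f ⟹ wpair_in x z f ⟹ y ≐ z.

Definition wone_to_one_onto (f a b : nat) : wprop :=
  (∀ p, p ∈ f ⟹ ∃ x y, wis_pair p x y) ∧ wFUNC f
  ∧ (∀ x, x ∈ a ⟺ ∃ y, wpair_in x y f)
  ∧ (∀ y, y ∈ b ⟺ ∃ x, wpair_in x y f)
  ∧ (∀ x z y, wpair_in x y f ⟹ wpair_in z y f ⟹ x ≐ z).

Definition winfinite (a : nat) : wprop :=
  ∃ b, (∀ x, x ∈ b ⟹ x ∈ a) ∧ ¬ b ≐ a ∧ ∃ f, wone_to_one_onto f a b.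

Definition wsucc_graph (n f : nat) : wprop :=
  wis_set f (fun p => (∃ x y, wis_pair p x y ∧ x ∈ n ∧ wsucc x y)%wp).

Lemma succ_graph_intro (n f x y : nat) (G : list form) :
  G ⊩ wsucc_graph n f -> G ⊩ x ∈ n -> G ⊩ wsucc x y -> G ⊩ wpair_in x y f.
Proof.
  intros Hf Hx Hy. pose proof (pair_ex x y G) as K. wex K as p Hp.
  wexists p. split; [exact Hp|]. apply (set_intro _ _ _ _ Hf).
  wexists x. wexists y. exact (conj Hp (conj Hx Hy)).
Qed.

Lemma succ_graph_elim (n f x y : nat) (G : list form) :
  G ⊩ wsucc_graph n f -> G ⊩ wpair_in x y f -> G ⊩ x ∈ n ∧ wsucc x y.
Proof.
  intros Hf K. wex K as p [Hp K]. apply (set_elim _ _ _ _ Hf) in K.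
  wex K as x' K. wex K as y' (Hp' & Hx & Hy).
  pose proof (pair_fst _ _ _ _ _ _ Hp' Hp) as Ex.
  pose proof (pair_snd _ _ _ _ _ _ Hp' Hp) as Ey.
  split; [exact (eq_in_l _ _ _ _ Ex Hx)|].
  exact (succ_eq_r _ _ _ _ Ey (succ_eq_l _ _ _ _ Ex Hy)).
Qed.

Lemma not_finite_infinite (n : nat) (G : list form) :
  G ⊩ wis_set n wNN -> G ⊩ (¬ wfinite n) -> G ⊩ winfinite n.
Proof.
  intros Hn NF.
  (* The proper subset [b] is the image of [n] under the successor. *)
  assert (K : G ⊩ (∃ b, wis_set b
    (fun y => (∃ x, x ∈ n ∧ wsucc x y)%wp))).
  { refine (comprehend ((∃ x, x ∈ 0 ∧ is_set 1 (Ap Succ x))%hf 2) [n] G _).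
    stratify. }
  wex K as b Hb.
  assert (K : G ⊩ (∃ f, wsucc_graph n f)).
  { refine (comprehend ((∃ x y, is_pair 1 x y ∧ x ∈ 0
      ∧ is_set y (Ap Succ x))%hf 2) [n] G _). stratify. }
  wex K as f Hf.
  wexists b. split; [|split].
  - intro y. wintro K. apply (set_elim _ _ _ _ Hb) in K.
    wex K as x [Hx Hy]. exact (succ_in_N _ _ _ _ Hn Hx Hy).
  (* If [b] were [n], zero would be a successor. *)
  - wintro E. pose proof (zero_ex G) as K. wex K as z Hz.
    pose proof (zero_in_N _ _ _ Hn Hz) as K.
    apply (eq_in_r _ _ _ _ (eq_sym_w _ _ _ E)), (set_elim _ _ _ _ Hb) in K.
    wex K as x [Hx Hxz]. exact (zero_not_succ _ _ _ _ Hn NF Hx Hz Hxz).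
  - wexists f. split; [|split; [|split; [|split]]].
    + intro p. wintro K. apply (set_elim _ _ _ _ Hf) in K.
      wex K as x K. wex K as y [Hp _]. wexists x. wexists y. exact Hp.
    + intros x y z. wintro Hy. wintro Hz.
      apply (succ_graph_elim _ _ _ _ _ Hf) in Hy, Hz.
      exact (succ_unique _ _ _ _ (proj2 Hy) (proj2 Hz)).
    + intro x. split; wintro K.
      * pose proof (succ_ex x G) as L. wex L as y Hy. wexists y.
        exact (succ_graph_intro _ _ _ _ _ Hf K Hy).
      * wex K as y Hy. exact (proj1 (succ_graph_elim _ _ _ _ _ Hf Hy)).
    + intro y. split; wintro K.
      * apply (set_elim _ _ _ _ Hb) in K. wex K as x [Hx Hy]. wexists x.
        exact (succ_graph_intro _ _ _ _ _ Hf Hx Hy).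
      * wex K as x Hx. apply (set_intro _ _ _ _ Hb). wexists x.
        exact (succ_graph_elim _ _ _ _ _ Hf Hx).
    + intros x z y. wintro Hx. wintro Hz.
      apply (succ_graph_elim _ _ _ _ _ Hf) in Hx, Hz.
      exact (succ_inj _ _ _ _ _ Hn NF (proj1 Hx) (proj1 Hz)
               (proj2 Hx) (proj2 Hz)).
Qed.

(** "The set N of Church numbers satisfies B" is rendered as "some n is equal
    to {x : NN x} and satisfies B". *)
Theorem theorem19p19 :
  INF_proves (sentence (∃ n, is_set n NN ∧ (¬ finite n ⟹ infinite n))).
Proof.
  assert (H : [] ⊩ (∃ n, wis_set n wNN ∧ (¬ wfinite n ⟹ winfinite n))).
  { assert (K : [] ⊩ (∃ n, wis_set n wNN)).
    { refine (comprehend (NN 0 1) [] [] _). stratify. }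
    apply (ex_elim _ _ _ K). intros n G _ Hn. wexists n.
    split; [exact Hn|]. wintro NF. exact (not_finite_infinite n G Hn NF). }
  (* [env []] is the identity, so forcing at the empty context is derivability of the sentence
     itself. *)
  unfold INF_proves. rewrite <- (ren_id (sentence _)).
  apply (sem_nd _ (env [])). exact H.
Qed.
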